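(* Let the source condition be fulfilled, i.e. there is $w\in Y$ with $\xi:=K^*w\in\partial R(x^\dagger)$. Let $\phi(\alpha)=\|Kx_\alpha^\delta-y^\delta\|^2/\alpha$ and let $\alpha^*$ be defined as $$\alpha^*\in\operatorname*{argmin}_{\alpha\in[0,\|K\|^2]}\phi(\alpha).$$ If furthermore $\delta^*:=\|Kx_{\alpha^*}^\delta-y^\delta\|\neq0$, then there exists a constant $C>0$ such that $$D_{\xi}(x_{\alpha^*}^\delta,x^\dagger)\le C\Bigl(1+\bigl(\tfrac{\delta}{\delta^*}\bigr)^2\Bigr)\max(\delta,\delta^* ).$$
   Context: $X$ is a Banach space, $Y$ a Hilbert space, and $K:X\to Y$ a bounded linear operator with adjoint $K^*:Y\to X^*$. The functional $R:X\to[0,\infty]$ is proper, convex, weakly lower semicontinuous and coercive. The exact data $y^\dagger$ lie in the range of $K$, and the noisy data $y^\delta\in Y$ satisfy $\|y^\dagger-y^\delta\|\le\delta$. $x_\alpha^\delta$ denotes a minimizer over $x\in X$ of $\tfrac12\|Kx-y^\delta\|^2+\alpha R(x)$, where $\alpha$ is the regularization parameter; the conditions on $R$ are taken to ensure that minimizers exist. $x^\dagger$ is a minimum-$R$ solution of $Kx=y^\dagger$, i.e. it minimizes $R$ among all solutions of this equation. $\partial R(x)\subset X^*$ is the subdifferential of $R$ at $x$. For $\xi\in\partial R(x)$ the Bregman distance is $D_\xi(x',x)=R(x')-R(x)-\langle\xi,x'-x\rangle$. *)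

(* Defs.v *)
From HB Require Import structures.
From mathcomp Require Import all_boot all_order all_algebra.
From mathcomp Require Import all_classical all_reals all_analysis.
From mathcomp Require Import ring.

Set Implicit Arguments.
Unset Strict Implicit.
Unset Printing Implicit Defensive.
Import Order.TTheory GRing.Theory Num.Theory.
Import numFieldNormedType.Exports.
Local Open Scope classical_set_scope.
Local Open Scope ring_scope.

(* Minimizers of [f] over [A]. As usual in convex analysis, [argmin] is empty
   when [f] is identically +oo on [A]. *)
Definition argmin (F : realType) (T : Type) (A : set T) (f : T -> \bar F) :
    set T :=
  [set x | [/\ A x, (f x < +oo)%E & forall y, A y -> (f x <= f y)%E]].

Section Banach.
Context {F : realType}.

Definition dual (X : normedModType F) : set (X -> F^o) :=
  [set f | linear f /\ continuous f].
Arguments dual X : clear implicits.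

(* The weak topology is the coarsest one making all evaluations x |-> l x,
   l in the dual, continuous, i.e. the initial topology of the evaluation map
   into the product of copies of F indexed by the dual. *)
Definition weak_eval (X : normedModType F) (x : X) : {ptws dual X -> F} :=
  fun l => set_val l x.

Definition weakly_lower_semicontinuous (X : normedModType F)
    (R : X -> \bar F) :=
  lower_semicontinuous (R : initial_topology (@weak_eval X) -> \bar F).

Definition proper_functional (X : normedModType F) (R : X -> \bar F) :=
  (forall x, R x != -oo%E) /\ exists x, (R x < +oo)%E.

Definition convex_functional (X : normedModType F) (R : X -> \bar F) :=
  forall (x y : X) (t : F), 0 <= t <= 1 ->
    (R (t *: x + (1 - t) *: y)%R <= t%:E * R x + (1 - t)%:E * R y)%E.

Definition coercive_functional (X : normedModType F) (R : X -> \bar F) :=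
  forall M : F, exists r : F, forall x : X, r <= `|x| -> (M%:E <= R x)%E.

Definition subdifferential (X : normedModType F) (R : X -> \bar F) (x : X) :
    set (X -> F^o) :=
  [set xi | [/\ dual X xi, (R x < +oo)%E &
    forall x', (R x + (xi (x' - x)%R)%:E <= R x')%E]].

Definition bregman (X : normedModType F) (R : X -> \bar F) (xi : X -> F^o)
    (x' x : X) : \bar F :=
  (R x' - R x - (xi (x' - x)%R)%:E)%E.

Definition opnorm (X Y : normedModType F) (K : X -> Y) : F :=
  sup [set `|K x| | x in [set x : X | `|x| <= 1]].

(* K^* w, the functional x |-> <w, K x>, with Y identified with its dual. *)
Definition adjoint (X Y : normedModType F) (ip : {dot Y for idfun})
    (K : {linear X -> Y}) (w : Y) : X -> F^o :=
  fun x => ip w (K x).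

Lemma cauchy_schwarz (Y : normedModType F) (ip : {dot Y for idfun}) :
  (forall y : Y, `|y| ^+ 2 = ip y y) -> forall u v, `|ip u v| <= `|u| * `|v|.
Proof.
move=> ipE u v; have [->|v0] := eqVneq v 0.
  by rewrite linear0r !normr0 mulr0.
have nv : 0 < `|v| by rewrite normr_gt0.
have vu : ip v u = ip u v by rewrite (hermC ip) /= expr0 mul1r.
have [t e] : exists t, ip u v = t * `|v| ^+ 2.
  by exists (ip u v / `|v| ^+ 2); rewrite divfK// expf_neq0// gt_eqF.
have : 0 <= ip (u - t *: v) (u - t *: v) by rewrite -ipE exprn_ge0.
rewrite linearBr !linearBl !linearZr_LR !linearZl_LR /= vu -!ipE e => h.
have {h} : ip u v ^+ 2 <= (`|u| * `|v|) ^+ 2.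
  have := mulr_ge0 h (sqr_ge0 `|v|).
  rewrite e -[_ <= (`|u| * _) ^+ 2]subr_ge0 /GRing.scale /=.
  by congr (0 <= _); ring.
move=> h; rewrite -(@ler_pXn2r _ 2) ?nnegrE ?mulr_ge0//.
by rewrite -e real_normK ?num_real.
Qed.

Lemma adjoint_dual (X Y : normedModType F) (ip : {dot Y for idfun})
    (K : {linear X -> Y}) (w : Y) :
  (forall y : Y, `|y| ^+ 2 = ip y y) -> bounded_near K (nbhs (0 : X)) ->
  dual X (adjoint ip K w).
Proof.
move=> ipE Kb.
have lf : linear (adjoint ip K w).
  by move=> a x y; rewrite /adjoint linearP linearDr linearZr_LR.
split=> //.
pose f : {linear X -> F^o} := HB.pack (adjoint ip K w)
  (GRing.isLinear.Build _ _ _ _ _ lf).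
apply: (bounded_linear_continuous (f := f)).
have /linear_boundedP [M [Mr HM]] := Kb.
apply/linear_boundedP; near=> r => x.
apply: le_trans (cauchy_schwarz ipE _ _) _.
have M1 : M < Num.max M 0 + 1 by rewrite ltr_pwDr// le_max lexx.
apply: le_trans (ler_wpM2l (normr_ge0 w) (HM _ M1 x)) _.
rewrite mulrA ler_wpM2r//; near: r; exact: nbhs_pinfty_ge (num_real _).
Unshelve. all: by end_near.
Qed.

Definition tikhonov (X Y : normedModType F) (K : X -> Y) (R : X -> \bar F)
    (y : Y) (alpha : F) (x : X) : \bar F :=
  ((2^-1 * `|K x - y| ^+ 2)%:E + alpha%:E * R x)%E.

(* [xa alpha] is the regularized solution for the parameter alpha > 0; the
   quotient |K x_alpha - y|^2 / alpha gets the value +oo at alpha = 0, where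
   it is not defined. *)
Definition phi (X Y : normedModType F) (K : X -> Y) (y : Y) (xa : F -> X)
    (alpha : F) : \bar F :=
  if alpha == 0 then +oo%E else (`|K (xa alpha) - y| ^+ 2 / alpha)%:E.

End Banach.

(* Main.v *)
(** With [k = |w|] and residual [r] at the parameter [alpha], comparing the
    minimizer with [xdag] and using the source condition gives
      [r^2 + 2 alpha D <= delta^2 + 2 alpha k (r + delta)],
    where [D >= 0] is the Bregman distance.  Dropping [D] yields
    [r <= delta + 2 alpha k], hence [phi alpha <= (delta + 2 alpha k)^2 / alpha].
    Let [m = max delta deltastar].  As [m] is bounded, some [alpha <= |K|^2] is
    proportional to [m], so [phi alphastar <= A m] by minimality.  The estimate
    for [D] at [alphastar] contains [delta^2 / alphastar], which equals
    [(delta / deltastar)^2 * phi alphastar]. *)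

Require Import Defs.
From HB Require Import structures.
From mathcomp Require Import all_boot all_order all_algebra.
From mathcomp Require Import all_classical all_reals all_analysis.
From mathcomp Require Import ring lra.

Set Implicit Arguments.
Unset Strict Implicit.
Unset Printing Implicit Defensive.
Import Order.TTheory GRing.Theory Num.Theory.
Import numFieldNormedType.Exports.
Local Open Scope classical_set_scope.
Local Open Scope ring_scope.

(** Minimality is tested against [xdag]; the pairing of [w] with [K (x - xdag)] is bounded by
    Cauchy-Schwarz and the triangle inequality through [ydelta]. The real witness [D] records that
    the Bregman distance is finite. *)
Lemma tikhonov_bregman_estimate (F : realType) (X Y : normedModType F)
    (ip : {dot Y for idfun}) (K : {linear X -> Y}) (R : X -> \bar F)
    (xdag : X) (w ydelta : Y) (delta alpha : F) (x : X) :
  (forall y : Y, `|y| ^+ 2 = ip y y) ->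
  (forall x, R x != -oo%E) ->
  subdifferential R xdag (adjoint ip K w) ->
  `|K xdag - ydelta| <= delta -> 0 < alpha ->
  argmin setT (tikhonov K R ydelta alpha) x ->
  let r := `|K x - ydelta| in
  exists D : F, [/\ bregman R (adjoint ip K w) x xdag = D%:E, 0 <= D &
    r ^+ 2 + 2 * alpha * D <=
      delta ^+ 2 + 2 * alpha * `|w| * (r + delta)].
Proof.
move=> ipE RNy [_ Rdag_fin sub] le_delta alpha0 [_ Tfin /(_ xdag I)] /=.
have [rd Rd] : exists rd, R xdag = rd%:E.
  by move: Rdag_fin (RNy xdag); case: (R xdag) => // a; exists a.
(* As [alpha > 0], [R x = +oo] would make the Tikhonov value infinite, which [argmin] excludes. *)
have [rx Rx] : exists rx, R x = rx%:E.
  move: Tfin (RNy x); rewrite /tikhonov; case: (R x) => // [a _ _|].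
    by exists a.
  by rewrite gt0_muley ?lte_fin.
have := sub x; rewrite /tikhonov /bregman Rd Rx -!EFinM -!EFinD !lee_fin.
move=> subx minx; exists (rx - rd - adjoint ip K w (x - xdag)).
split=> //; first lra.
have d0 := le_trans (normr_ge0 _) le_delta.
have le_delta2 : `|K xdag - ydelta| ^+ 2 <= delta ^+ 2.
  by rewrite ler_pXn2r ?nnegrE.
have pair_ge : - (`|w| * (`|K x - ydelta| + delta)) <= adjoint ip K w (x - xdag).
  rewrite lerNl; apply: le_trans (ler_norm _) _; rewrite normrN.
  apply: le_trans (cauchy_schwarz ipE _ _) _; rewrite ler_wpM2l// linearB /=.
  apply: le_trans (ler_distD ydelta _ _) _.
  by rewrite lerD2l distrC.
have := ler_wpM2l (ltW alpha0) pair_ge.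
lra.
Qed.

Lemma tikhonov_residual_le (F : realType) (X Y : normedModType F)
    (ip : {dot Y for idfun}) (K : {linear X -> Y}) (R : X -> \bar F)
    (xdag : X) (w ydelta : Y) (delta alpha : F) (x : X) :
  (forall y : Y, `|y| ^+ 2 = ip y y) ->
  (forall x, R x != -oo%E) ->
  subdifferential R xdag (adjoint ip K w) ->
  `|K xdag - ydelta| <= delta -> 0 < alpha ->
  argmin setT (tikhonov K R ydelta alpha) x ->
  `|K x - ydelta| <= delta + 2 * alpha * `|w|.
Proof.
move=> ipE RNy src le_delta alpha0 minx.
have [D [_ D0]] :=
  tikhonov_bregman_estimate ipE RNy src le_delta alpha0 minx.
have d0 := le_trans (normr_ge0 _) le_delta.
set r := `|_ - _|; have r0 : 0 <= r by rewrite normr_ge0.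
have aD0 : 0 <= alpha * D by rewrite mulr_ge0// ltW.
have ak0 : 0 <= alpha * `|w| by rewrite mulr_ge0// ltW.
(* Cancels [r + delta] from [r^2 - delta^2 <= 2 alpha |w| (r + delta)]; arguing by contradiction
   gives [r > 0], hence a nonzero factor. *)
move=> h; rewrite leNgt; apply/negP => hlt.
have : 0 < (r - delta - 2 * alpha * `|w|) * (r + delta).
  by apply: mulr_gt0; lra.
lra.
Qed.

Theorem theorem3p1 (F : realType) (X Y : completeNormedModType F)
    (ip : {dot Y for idfun}) (ip_norm : forall y : Y, `|y| ^+ 2 = ip y y)
    (K : {linear X -> Y}) (K_bounded : bounded_near K (nbhs (0 : X)))
    (R : X -> \bar F) (R_ge0 : forall x, (0 <= R x)%E)
    (R_proper : proper_functional R) (R_convex : convex_functional R)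
    (R_wlsc : weakly_lower_semicontinuous R) (R_coercive : coercive_functional R)
    (ydag : Y) (ydag_range : range K ydag)
    (xdag : X) (xdag_minR : argmin [set x | K x = ydag] R xdag)
    (w : Y) (source : subdifferential R xdag (adjoint ip K w))
    (delta_max : F) :
  exists C : F, 0 < C /\
    forall (delta : F) (ydelta : Y) (xa : F -> X) (alphastar : F),
      delta <= delta_max ->
      `|ydag - ydelta| <= delta ->
      (forall alpha, 0 < alpha ->
         argmin setT (tikhonov K R ydelta alpha) (xa alpha)) ->
      argmin [set alpha | 0 <= alpha <= opnorm K ^+ 2]
        (phi K ydelta xa) alphastar ->
      let deltastar := `|K (xa alphastar) - ydelta| in
      deltastar != 0 ->
      (bregman R (adjoint ip K w) (xa alphastar) xdag <=
        (C * (1 + (delta / deltastar) ^+ 2) * Num.max delta deltastar)%:E)%E.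
Proof.
have [RNy _] := R_proper; have [Kxdag _ _] := xdag_minR.
set kappa := opnorm K ^+ 2; set k := `|w|.
have kappa_ge0 : 0 <= kappa by rewrite sqr_ge0.
have k0 : 0 <= k by rewrite normr_ge0.
(* A bound for [max delta deltastar] that is uniform in the data, by the residual estimate with
   [alphastar <= kappa]; the [+ 1] makes it positive. *)
pose T := `|delta_max| + 2 * kappa * k + 1.
have kk0 : 0 <= kappa * k by rewrite mulr_ge0.
have T0 : 0 < T by have := normr_ge0 delta_max; rewrite /T; lra.
(* [A * m] equals [((1 + 2 * kappa / T * k) * m)^2 / b] at the competitor [b = kappa / T * m]. If
   [kappa = 0], the convention [T / 0 = 0] gives [A = 0]. *)
pose A := (1 + 2 * kappa / T * k) ^+ 2 * (T / kappa).
have A0 : 0 <= A by rewrite mulr_ge0 ?sqr_ge0// divr_ge0// ltW.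
exists (A + 2 * k + 1); split; first lra.
move=> delta ydelta xa a delta_le noise xa_min [/= /andP[a_ge0 a_le]].
(* A minimizer has a finite value, so it is not 0; this also forces [kappa > 0]. *)
rewrite /phi; have [->|a_neq0] := eqVneq a 0; first by rewrite ltxx.
move=> _ phi_min; set ds := `|K (xa a) - ydelta| => ds_neq0.
have a0 : 0 < a by rewrite lt_def a_neq0.
have kappa0 : 0 < kappa := lt_le_trans a0 a_le.
have ds0 : 0 < ds by rewrite lt_def ds_neq0 normr_ge0.
move: noise; rewrite -Kxdag => noise.
have d0 := le_trans (normr_ge0 _) noise.
have ds_le := tikhonov_residual_le ip_norm RNy source noise a0 (xa_min _ a0).
rewrite -/ds -/k in ds_le.
have ak : a * k <= kappa * k by rewrite ler_wpM2r.
set m := Num.max delta ds.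
have dm : delta <= m by rewrite le_max lexx.
have dsm : ds <= m by rewrite le_max lexx orbT.
have m0 : 0 < m := lt_le_trans ds0 dsm.
have mT : m <= T by have := ler_norm delta_max; rewrite /T ge_max; lra.
(* Admissible as a competitor for [phi] because [m <= T]. *)
pose b := kappa / T * m.
have b0 : 0 < b by rewrite mulr_gt0// divr_gt0.
have b_le : b <= kappa by rewrite /b mulrAC ler_pdivrMr// ler_wpM2l.
have phi_le : ds ^+ 2 / a <= A * m.
  have := phi_min b; rewrite /= (ltW b0) b_le (gt_eqF b0) lee_fin => /(_ isT).
  move/le_trans; apply.
  have := tikhonov_residual_le ip_norm RNy source noise b0 (xa_min _ b0).
  rewrite -/k => rb_le.
  have -> : A * m = ((1 + 2 * kappa / T * k) * m) ^+ 2 / b.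
    by rewrite /A /b; field; rewrite !gt_eqF.
  rewrite ler_pM2r ?invr_gt0// ler_pXn2r ?nnegrE//.
    by apply: le_trans rb_le _; rewrite /b; lra.
  rewrite mulr_ge0 ?(ltW m0)// addr_ge0// mulr_ge0// divr_ge0 ?(ltW T0)//.
  by rewrite mulr_ge0.
have [D [-> _]] :=
  tikhonov_bregman_estimate ip_norm RNy source noise a0 (xa_min _ a0).
rewrite -/ds -/k lee_fin => D_le.
set s := (delta / ds) ^+ 2; have s0 : 0 <= s by rewrite sqr_ge0.
have phiE : s * (ds ^+ 2 / a) = delta ^+ 2 / a.
  by rewrite /s; field; rewrite !gt_eqF.
have D_le2 : 2 * D <= s * (ds ^+ 2 / a) + 2 * k * (ds + delta).
  rewrite phiE -(ler_pM2l a0).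
  have -> : a * (delta ^+ 2 / a + 2 * k * (ds + delta)) =
            delta ^+ 2 + 2 * a * k * (ds + delta) by field; rewrite gt_eqF.
  by have := sqr_ge0 ds; lra.
have := ler_wpM2l s0 phi_le.
have : k * (ds + delta) <= k * (2 * m) by rewrite ler_wpM2l//; lra.
(* So far [D <= s * A * m / 2 + 2 * k * m]; the other terms in the expansion of
   [(A + 2 * k + 1) * (1 + s) * m] are nonnegative. *)
have Am0 : 0 <= A * m by rewrite mulr_ge0// ltW.
have km0 : 0 <= k * m by rewrite mulr_ge0// ltW.
have sAm0 : 0 <= s * (A * m) by rewrite mulr_ge0.
have skm0 : 0 <= s * (k * m) by rewrite mulr_ge0.
have sm0 : 0 <= s * m by rewrite mulr_ge0// ltW.
lra.
Qed.
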